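(* Let $q$ be an even prime power (a power of $2$, $q\ge 2$), let $a,b\in\mathbb F_{q^2}$, and let $f=a\mathtt x+b\mathtt x^q+\mathtt x^{2q-1}\in\mathbb F_{q^2}[\mathtt x]$. Then $f$ is a permutation polynomial of $\mathbb F_{q^2}$ if and only if one of the following is satisfied. (i) $a=b=0$ and $q=2^{2k}$ for some positive integer $k$. (ii) $ab\ne 0$, $a=b^{1-q}$, and $\mathrm{Tr}_{q/2}(b^{-1-q})=0$. (iii) $ab(a-b^{1-q})\ne 0$, $\frac{a}{b^2}\in\mathbb F_q$, $\mathrm{Tr}_{q/2}\left(\frac{a}{b^2}\right)=0$, and $b^2+a^2b^{q-1}+a=0$.
   Context: $\mathbb F_q$ denotes the finite field with $q$ elements, and $\mathbb F_q\subset\mathbb F_{q^2}$ is regarded as a subfield; $\mathtt x$ is an indeterminate. A polynomial $f\in\mathbb F_{q^2}[\mathtt x]$ is called a permutation polynomial of $\mathbb F_{q^2}$ if the map $x\mapsto f(x)$ is a permutation of $\mathbb F_{q^2}$. $\mathrm{Tr}_{q/2}:\mathbb F_q\to\mathbb F_2$ is the absolute trace, $\mathrm{Tr}_{q/2}(x)=x+x^2+x^{4}+\cdots+x^{q/2}$. For $b\in\mathbb F_{q^2}$, $b\ne 0$, one has $b^{-1-q}\in\mathbb F_q$. The condition $ab(a-b^{1-q})\ne 0$ means $a\neq 0$, $b\neq 0$ and $a\neq b^{1-q}$. *)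

(* Defs.v *)
From HB Require Import structures.
From mathcomp Require Import all_boot all_order all_algebra.

Set Implicit Arguments.
Unset Strict Implicit.
Unset Printing Implicit Defensive.

Import GRing.Theory.
Local Open Scope ring_scope.

Definition perm_poly (F : finFieldType) (f : {poly F}) : Prop :=
  bijective (fun x : F => f.[x]).

(* For #|K| = 2 ^ n this is x + x ^ 2 + x ^ 4 + ... + x ^ (2 ^ (n - 1)); the
   value lies in the prime field F_2, here viewed inside K. *)
Definition abs_trace2 (K : finFieldType) (x : K) : K :=
  \sum_(i < logn 2 #|K|) x ^+ (2 ^ i).

(* Main.v *)
Require Import Defs.
From HB Require Import structures.
From mathcomp Require Import all_boot all_order all_algebra.
From mathcomp Require Import cyclic finfield ring zify.

Set Implicit Arguments.
Unset Strict Implicit.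
Unset Printing Implicit Defensive.

Import GRing.Theory.
Local Open Scope ring_scope.

(** Write the trinomial as x * h(x^(q-1)) with h(y) = a + b y + y^2, and let mu
    be the group of y with y^(q+1) = 1. Since x |-> x^(q-1) maps the nonzero
    elements onto mu, the trinomial permutes the field if and only if h has no
    zero on mu and g(y) = y * h(y)^(q-1) is injective on mu [perm_polyP]. On
    mu, g is the rational function
    (a^q y^2 + b^q y + 1) / (y (y^2 + b y + a)).

    Necessity comes from power sums: if g permutes mu, then the sum of g^k over
    mu is the sum of y^k, which is zero for 0 < k <= q. For b != 0 put
    A = a / b^2. The case k = 1 says that A is nonzero and that
    A + A^2 + ... + A^(q/2) = 0 [circle_perm_trace]; this also puts A in the
    subfield, because t |-> t + t^2 + ... + t^(q/2) maps t^2 + t to t^q + t.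
    For b = 0 it says that a = 0 [circle_perm_b0], and then g(y) = y^(-3) is
    injective exactly when 3 does not divide q + 1 [circle_perm00].

    Let b != 0. If a = b^(1-q) then g(y) is a constant times 1 / y
    [circle_perm_degenerate]. Otherwise, rescaling y by an element of mu puts a
    and b in the subfield, and a != 1. The roots of h are then r, s in the
    subfield, by additive Hilbert 90. With the involutions
    M_t(y) = (1 + t y) / (y + t) of mu, g(y) is M_r(y) M_s(y) / y, which partial
    fractions turn into a linear combination of 1 / y, M_r(y), M_s(y). Any two
    of these three functions X, Y satisfy X Y = k (X + Y) + 1 for a constant k,
    so the sum of g^3 can be evaluated; its vanishing amounts to
    (b^2 + a^2 + a) (b + 1 + a)^2 = 0, where b + 1 + a = h(1) is not zero
    [circle_perm_necessary].

    Conversely let b^2 = a^2 + a and let the trace of A be zero. If g(x) = g(y)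
    with x != y in mu, put e = x + y. Then w = x / e satisfies w^q = w + 1, so
    w^2 + w = x y / e^2 has trace one; but g(x) = g(y) shows that x y / e^2 is A
    plus an element v^2 + v with v in the subfield, which has trace zero
    [circle_perm_sufficient]. *)

(** * Computing in characteristic two *)

Lemma even_natr (R : nzRingType) (m : nat) :
  2%:R = 0 :> R -> ~~ odd m -> m%:R = 0 :> R.
Proof.
move=> R2 /negbTE m_even.
by rewrite -[m]odd_double_half m_even add0n -muln2 natrM R2 mulr0.
Qed.

Lemma even_oppr (R : nzRingType) (m : nat) :
  2%:R = 0 :> R -> ~~ odd m -> - m%:R = 0 :> R.
Proof. by move=> R2 m_even; rewrite even_natr ?oppr0. Qed.

(* An equation m = 0 eliminates only the monomials whose coefficient is exactly
   m, so every even coefficient that may occur is listed. *)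
Ltac ring2 h :=
  apply: subr0_eq; ring: h
    (@even_natr _ 4 h isT) (@even_natr _ 6 h isT) (@even_natr _ 8 h isT)
    (@even_natr _ 10 h isT) (@even_natr _ 12 h isT)
    (@even_oppr _ 2 h isT) (@even_oppr _ 4 h isT) (@even_oppr _ 6 h isT)
    (@even_oppr _ 8 h isT) (@even_oppr _ 10 h isT) (@even_oppr _ 12 h isT).

Ltac field2 h :=
  apply: subr0_eq; field: h
    (@even_natr _ 4 h isT) (@even_natr _ 6 h isT) (@even_natr _ 8 h isT)
    (@even_natr _ 10 h isT) (@even_natr _ 12 h isT)
    (@even_oppr _ 2 h isT) (@even_oppr _ 4 h isT) (@even_oppr _ 6 h isT)
    (@even_oppr _ 8 h isT) (@even_oppr _ 10 h isT) (@even_oppr _ 12 h isT).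

(** * The polynomial trace in characteristic two *)

Section Trace.

Variables (F : fieldType) (n : nat).
Hypothesis F2 : 2%N \in [pchar F].

(** The polynomial X + X^2 + ... + X^(2^(n-1)) as a function on a field that
    may be larger than the field with 2^n elements. *)
Definition tr2 (x : F) : F := \sum_(i < n) x ^+ (2 ^ i).

Lemma two_eq0 : 2%:R = 0 :> F.
Proof. exact: pcharf0 F2. Qed.

Lemma exprD_pow2 (k : nat) (x y : F) :
  (x + y) ^+ (2 ^ k) = x ^+ (2 ^ k) + y ^+ (2 ^ k).
Proof. by apply: exprDn_pchar; rewrite (eq_pnat _ (pcharf_eq F2)) pnatX. Qed.

Lemma sqrrD_pchar2 (x y : F) : (x + y) ^+ 2 = x ^+ 2 + y ^+ 2.
Proof. exact: (exprD_pow2 1). Qed.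

Lemma sum_sqr_pchar2 (I : finType) (P : pred I) (G : I -> F) :
  \sum_(i | P i) G i ^+ 2 = (\sum_(i | P i) G i) ^+ 2.
Proof.
apply: (big_rec2 (fun x y => x = y ^+ 2)); first by rewrite expr0n.
by move=> i x y _ ->; rewrite sqrrD_pchar2.
Qed.

Lemma tr2D x y : tr2 (x + y) = tr2 x + tr2 y.
Proof. by rewrite -big_split; apply: eq_bigr => i _; rewrite exprD_pow2. Qed.

Lemma tr2_sqr x : tr2 x ^+ 2 = tr2 (x ^+ 2).
Proof.
by rewrite -sum_sqr_pchar2; apply: eq_bigr => i _; rewrite -!exprM mulnC.
Qed.

Lemma tr2_artin_schreier x : tr2 (x ^+ 2 + x) = x ^+ (2 ^ n) + x.
Proof.
rewrite /tr2; elim: n => [|k IHk].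
  by rewrite big_ord0 expn0 expr1; apply/esym/addrr_pchar2.
rewrite big_ord_recr IHk /= exprD_pow2 -exprM -expnS.
by ring2 two_eq0.
Qed.

Lemma tr2_eq0_frob x : tr2 x = 0 -> x ^+ (2 ^ n) = x.
Proof.
move=> trx0; apply/subr0_eq; rewrite GRing.subr_pchar2 //.
by rewrite -tr2_artin_schreier tr2D -tr2_sqr trx0 expr0n addr0.
Qed.

End Trace.

Lemma tr2_rmorph (K L : fieldType) (iota : {rmorphism K -> L}) n x :
  iota (tr2 n x) = tr2 n (iota x).
Proof. by rewrite rmorph_sum; apply: eq_bigr => i _; rewrite rmorphXn. Qed.

(** Additive Hilbert 90 for the field with 2^n elements: X^2 + X + c divides
    X^(2^n) - X as soon as c has trace zero. *)
Lemma artin_schreier_root (K : finFieldType) (n : nat) (c : K) :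
  (0 < n)%N -> #|K| = (2 ^ n)%N -> tr2 n c = 0 -> exists z : K, z ^+ 2 + z = c.
Proof.
move=> n_gt0 cardK trc0.
have K2 : 2%N \in [pchar K] by apply: card_finPcharP cardK _.
pose u : {poly K} := 'X^2 + 'X + c%:P.
have size_u : size u = 3.
  by rewrite /u -addrA size_polyDl ?size_polyXn // size_XaddC.
have P2 : 2%N \in [pchar {poly K}] by rewrite pchar_poly.
have expP k x y : (x + y : {poly K}) ^+ (2 ^ k) = x ^+ (2 ^ k) + y ^+ (2 ^ k).
  by apply: exprDn_pchar; rewrite (eq_pnat _ (pcharf_eq P2)) pnatX.
(* Telescoping: tr2 (X^2 + X + c) = X^(2^n) + X + tr2 c. *)
have tele k : \sum_(i < k) u ^+ (2 ^ i) =
    'X^(2 ^ k) + 'X + (\sum_(i < k) c ^+ (2 ^ i))%:P.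
  elim: k => [|k IHk].
    by rewrite !big_ord0 expn0 expr1 addr0 (addrr_pchar2 P2).
  rewrite !big_ord_recr IHk /= /u !expP -exprM -expnS polyCD polyC_exp.
  by ring2 (pcharf0 P2 : 2%:R = 0 :> {poly K}).
have u_dvd : u %| 'X^(#|K|) - 'X.
  have -> : 'X^(#|K|) - 'X = \sum_(i < n) u ^+ (2 ^ i) :> {poly K}.
    by rewrite tele -/(tr2 n c) trc0 addr0 (GRing.subr_pchar2 P2) cardK.
  apply: (big_ind (fun p => u %| p)); first exact: dvdp0.
    by move=> x y; apply: dvdp_add.
  by move=> i _; rewrite dvdp_exp ?expn_gt0.
rewrite finField_genPoly in u_dvd.
have [m u_eq] := dvdp_prod_XsubC u_dvd.
have /eqp_size : u %= \prod_(z <- mask m (index_enum K)) ('X - z%:P) by [].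
rewrite size_u size_prod_XsubC => -[].
case E : (mask m (index_enum K)) => [//|z s] _; exists z.
have : root u z by rewrite (eqp_root u_eq) E root_prod_XsubC inE eqxx.
rewrite /root !hornerE => /eqP uz0.
by apply/subr0_eq; rewrite (GRing.subr_pchar2 K2).
Qed.

(** * The unit circle of a quadratic extension *)

Section Circle.

Variables (F : finFieldType) (n q : nat).
Hypothesis n_gt0 : (0 < n)%N.
Hypothesis q_def : q = (2 ^ n)%N.
Hypothesis cardF : #|F| = (q ^ 2)%N.

Lemma q_gt1 : (1 < q)%N.
Proof. by rewrite q_def -{1}(expn0 2) ltn_exp2l. Qed.

Lemma q_even : (q./2).*2 = q.
Proof. by rewrite -[RHS]odd_double_half q_def oddX gtn_eqF. Qed.

Lemma pchar2_F : 2%N \in [pchar F].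
Proof.
by apply: (card_finPcharP (n := (n * 2)%N)) => //; rewrite cardF q_def expnM.
Qed.

Lemma two0F : 2%:R = 0 :> F.
Proof. exact: two_eq0 pchar2_F. Qed.

Lemma addxx (x : F) : x + x = 0.
Proof. exact: addrr_pchar2 pchar2_F _. Qed.

Lemma addr_eq0F (x y : F) : (x + y == 0) = (x == y).
Proof. by rewrite addr_eq0 (oppr_pchar2 pchar2_F). Qed.

Lemma frobD (x y : F) : (x + y) ^+ q = x ^+ q + y ^+ q.
Proof. by rewrite q_def exprD_pow2 //; exact: pchar2_F. Qed.

Lemma frobK (x : F) : (x ^+ q) ^+ q = x.
Proof. by rewrite -exprM mulnn -cardF expf_card. Qed.

(** The elements of norm one over the subfield with q elements. *)
Definition circle : pred F := [pred y | y ^+ q.+1 == 1].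

Lemma circle_neq0 y : circle y -> y != 0.
Proof.
by apply: contraTneq => ->; rewrite /circle /= expr0n eq_sym oner_eq0.
Qed.

Lemma circle_frob y : circle y -> y ^+ q = y^-1.
Proof.
move=> yC; apply: (mulfI (circle_neq0 yC)).
by rewrite -exprS divff ?circle_neq0 // (eqP yC).
Qed.

Lemma circleP y : y != 0 -> y ^+ q = y^-1 -> circle y.
Proof. by move=> y0 yq; rewrite /circle /= exprS yq divff. Qed.

Lemma circle1 : circle 1.
Proof. by rewrite /circle /= expr1n. Qed.

Lemma circleM x y : circle x -> circle y -> circle (x * y).
Proof. by rewrite /circle /= exprMn => /eqP-> /eqP->; rewrite mulr1. Qed.

Lemma circleX k x : circle x -> circle (x ^+ k).
Proof. by rewrite /circle /= -exprM mulnC exprM => /eqP->; rewrite expr1n. Qed.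

Lemma circleV x : circle x -> circle x^-1.
Proof. by rewrite /circle /= exprVn => /eqP->; rewrite invr1. Qed.

Lemma frob_pred (x : F) : x != 0 -> x ^+ q.-1 = x ^+ q / x.
Proof.
move=> x0; rewrite -[in RHS](prednK (ltnW q_gt1)) exprS.
by rewrite mulrAC divff // mul1r.
Qed.

Lemma circle_frob_pred x : x != 0 -> circle (x ^+ q.-1).
Proof.
move=> x0; apply: circleP; first exact: expf_neq0.
by rewrite frob_pred // exprMn exprVn frobK invf_div.
Qed.

(** Hilbert 90 for the extension of degree two; 1 + y^-1 is a preimage of y. *)
Lemma circle_quotient y : circle y -> exists2 x : F, x != 0 & x ^+ q.-1 = y.
Proof.
move=> yC; have y0 := circle_neq0 yC; have [-> | y1] := eqVneq y 1.
  by exists 1; rewrite ?oner_eq0 ?expr1n.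
have x0 : 1 + y^-1 != 0.
  by rewrite addr_eq0F eq_sym invr_eq1.
exists (1 + y^-1) => //.
rewrite frob_pred // frobD expr1n exprVn circle_frob //.
rewrite invrK; apply: (canLR (mulfK x0)).
by rewrite mulrDr mulr1 divff // addrC.
Qed.

Lemma circle_sqrt y : circle y -> exists2 x, circle x & x ^+ 2 = y.
Proof.
move=> yC; exists (y ^+ (q./2).+1); first exact: circleX.
by rewrite -exprM muln2 doubleS q_even exprSr (eqP yC) mul1r.
Qed.

Lemma circle_fixed y : circle y -> y ^+ q = y -> y = 1.
Proof.
move=> yC yq; have y2 : y ^+ 2 = 1.
  by rewrite expr2 -{1}yq circle_frob // mulVf // circle_neq0.
apply/eqP; rewrite -addr_eq0F -sqrf_eq0 (sqrrD_pchar2 pchar2_F) y2 expr1n.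
by rewrite addxx.
Qed.

Lemma circle_generator : exists z : F, q.+1.-primitive_root z.
Proof.
have q21 : (q ^ 2).-1 = (q.-1 * q.+1)%N.
  by have := q_gt1; case: (q) => [|m] //= _; lia.
have q1_gt0 : (0 < q.-1)%N by rewrite -subn1 subn_gt0 q_gt1.
have /hasP[w _ w_prim] : has ((q ^ 2).-1).-primitive_root
    [seq x <- enum F | x != 0].
  apply: has_prim_root; last 2 first.
  - by rewrite filter_uniq // enum_uniq.
  - rewrite -cardF -(cardC1 (0 : F)) cardE; apply: uniq_leq_size.
      exact: enum_uniq.
    by move=> x; rewrite mem_enum mem_filter mem_enum !inE andbT.
  - by rewrite q21 muln_gt0 q1_gt0.
  apply/allP => x; rewrite mem_filter => /andP[x0 _].
  rewrite unity_rootE; apply/eqP/(mulfI x0).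
  by rewrite mulr1 -exprS prednK ?expn_gt0 ?(ltnW q_gt1) // -cardF expf_card.
exists (w ^+ q.-1); have := exp_prim_root w_prim q.-1.
by rewrite q21 (gcdn_idPl _) ?dvdn_mulr // mulKn.
Qed.

Lemma card_circle : #|circle| = q.+1.
Proof.
have [z z_prim] := circle_generator.
have <- : #|[set z ^+ (i : 'I_q.+1) | i : 'I_q.+1]| = q.+1.
  rewrite card_imset ?card_ord // => i j /eqP.
  by rewrite (eq_prim_root_expr z_prim) !modn_small // => /eqP/val_inj.
apply: eq_card => y; apply/idP/imsetP => [/eqP yC | [i _ ->]].
  by have [i ->] := prim_rootP z_prim yC; exists i.
rewrite unfold_in /circle /= -exprM mulnC exprM (prim_expr_order z_prim).
by rewrite expr1n.
Qed.

(** Multiplication by a generator of the circle shows that a nontrivial power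
    sum vanishes. *)
Lemma sum_circle_exp m :
  \sum_(y | circle y) y ^+ m = (q.+1 %| m)%N%:R.
Proof.
have [dvd_m | ndvd] := boolP (q.+1 %| m)%N.
  have [k ->] := dvdnP dvd_m; rewrite (eq_bigr (fun=> 1)) => [|y /eqP yC].
    have q0 : q%:R = 0 :> F by rewrite q_def natrX two0F expr0n gtn_eqF.
    by rewrite sumr_const card_circle mulrS q0 addr0.
  by rewrite mulnC exprM yC expr1n.
have [z z_prim] := circle_generator.
pose S := \sum_(y | circle y) y ^+ m.
have z0 : z != 0 by rewrite (prim_root_eq0 z_prim).
have zS : z ^+ m * S = S.
  rewrite {2}/S (reindex_inj (mulfI z0)) mulr_sumr.
  apply: eq_big => [y|y _]; last by rewrite exprMn.
  by rewrite /circle /= exprMn (prim_expr_order z_prim) mul1r.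
apply/eqP; rewrite -/S; apply: contraNT ndvd => S0.
by rewrite (prim_order_dvd z_prim); apply/eqP/(mulIf S0); rewrite mul1r.
Qed.

Lemma sum_circle_horner (p : {poly F}) :
  (size p <= q.+1)%N -> \sum_(y | circle y) p.[y] = p.[0].
Proof.
move=> size_p; pose c (m : nat) := p`_m.
have pE y : p.[y] = \sum_(m < q.+1) p`_m * y ^+ m by exact: horner_coef_wide.
rewrite (eq_bigr _ (fun y _ => pE y)) exchange_big /= big_ord_recl /=.
rewrite -mulr_sumr sum_circle_exp dvdn0 mulr1 big1 ?addr0 => [|i _].
  rewrite pE big_ord_recl /= big1 ?addr0 ?mulr1 // => i _.
  by rewrite expr0n mulr0.
by rewrite -mulr_sumr sum_circle_exp gtnNdvd ?mulr0 // ltnS ltn_ord.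
Qed.

Lemma sum_circle_perm (g : F -> F) (m : nat) :
  (forall y, circle y -> circle (g y)) -> {in circle &, injective g} ->
  \sum_(y | circle y) g y ^+ m = (q.+1 %| m)%N%:R.
Proof.
move=> gC g_inj; rewrite -sum_circle_exp.
pose C := [set y | circle y].
have gC_eq : g @: C = C.
  apply/eqP; rewrite eqEcard; apply/andP; split.
    by apply/subsetP => _ /imsetP[y yC ->]; rewrite !inE in yC *; apply: gC.
  by rewrite card_in_imset // => x y; rewrite !inE; apply: g_inj.
transitivity (\sum_(y in C) g y ^+ m).
  by apply: eq_bigl => y; rewrite inE.
rewrite -(big_imset (fun y => y ^+ m)) /=; last first.
  by move=> x y; rewrite !inE; apply: g_inj.
by rewrite gC_eq; apply: eq_bigl => y; rewrite inE.
Qed.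

(** * Reduction to the unit circle *)

(** The trinomial is x * quad (x ^ (q - 1)). *)
Definition quad (a b y : F) : F := a + b * y + y ^+ 2.

(** The map that the trinomial induces on the images x ^ (q - 1). *)
Definition induced (a b y : F) : F := y * quad a b y ^+ q.-1.

(** The property of a and b equivalent to the trinomial being a permutation
    polynomial. *)
Definition circle_perm (a b : F) : Prop :=
  (forall y, circle y -> quad a b y != 0) /\
  {in circle &, injective (induced a b)}.

Lemma perm_polyP (a b : F) :
  perm_poly (a *: 'X + b *: 'X^q + 'X^(2 * q - 1)) <-> circle_perm a b.
Proof.
pose f x := (a *: 'X + b *: 'X^q + 'X^(2 * q - 1)).[x].
have fE x : f x = x * quad a b (x ^+ q.-1).
  rewrite /f !hornerE /quad.
  have -> : (2 * q - 1 = (q.-1 * 2).+1)%N by have := q_gt1; lia.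
  rewrite -{1}(prednK (ltnW q_gt1)) !exprS exprM; ring.
have f_pred x : f x ^+ q.-1 = induced a b (x ^+ q.-1) by rewrite fE exprMn.
have f0 : f 0 = 0 by rewrite fE mul0r.
have quad0 y : circle y -> quad a b y = 0 -> exists2 x, x != 0 & f x = 0.
  move=> yC h0; have [x x0 xy] := circle_quotient yC.
  by exists x; rewrite // fE xy h0 mulr0.
split=> [[f' fK f'K] | [h0 g_inj]].
  have f_inj : injective f := can_inj fK.
  have h0 y : circle y -> quad a b y != 0.
    move=> yC; apply/eqP => /(quad0 _ yC)[x x0 fx0].
    by case/eqP: x0; apply: f_inj; rewrite fx0 f0.
  split=> // y y' yC y'C; have [x x0 xy] := circle_quotient yC.
  have [x' x'0 xy'] := circle_quotient y'C.
  rewrite -xy -xy' -!f_pred => fxx'.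
  have fx0 : f x != 0 by rewrite -f0 (inj_eq f_inj).
  (* f commutes with multiplication by c, because c^(q-1) = 1. *)
  pose c := f x' / f x; have c1 : c ^+ q.-1 = 1.
    by rewrite exprMn exprVn fxx' divff // -fxx' expf_neq0.
  have -> : x' = c * x.
    by apply: f_inj; rewrite [in RHS]fE exprMn c1 mul1r -mulrA -fE divfK.
  by rewrite exprMn c1 mul1r.
have f_eq0 x : f x = 0 -> x = 0.
  rewrite fE => /eqP; rewrite mulf_eq0 => /orP[/eqP // | /eqP hx0].
  apply: contraTeq isT => x0.
  by have := h0 _ (circle_frob_pred x0); rewrite hx0 eqxx.
apply: injF_bij => x x'; rewrite -!/(f _) => fxx'.
have [x0 | x0] := eqVneq x 0.
  by rewrite x0 f0 in fxx' *; rewrite (f_eq0 x').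
have [x'0 | x'0] := eqVneq x' 0.
  by rewrite x'0 f0 in fxx' *; rewrite (f_eq0 x).
have yy' : x ^+ q.-1 = x' ^+ q.-1.
  by apply: g_inj; rewrite -?f_pred ?fxx' //; apply: circle_frob_pred.
move: fxx'; rewrite !fE yy' => /mulIf; apply.
exact: h0 (circle_frob_pred x'0).
Qed.

Lemma quad_frob a b y : circle y ->
  quad a b y ^+ q = a ^+ q + b ^+ q / y + y ^- 2.
Proof.
move=> yC; rewrite /quad !frobD exprMn -exprM mulnC exprM (circle_frob yC).
by rewrite exprVn.
Qed.

Lemma inducedE a b y : circle y -> quad a b y != 0 ->
  induced a b y = (a ^+ q * y ^+ 2 + b ^+ q * y + 1) / (y * quad a b y).
Proof.
move=> yC hy0; have y0 := circle_neq0 yC.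
rewrite /induced frob_pred // quad_frob //; field.
by rewrite hy0 y0.
Qed.

Lemma induced_circle a b y :
  circle y -> quad a b y != 0 -> circle (induced a b y).
Proof. by move=> yC hy0; apply: circleM => //; apply: circle_frob_pred. Qed.

Lemma sum_induced a b k : circle_perm a b ->
  \sum_(y | circle y) induced a b y ^+ k = (q.+1 %| k)%N%:R.
Proof.
case=> h0 g_inj; apply: sum_circle_perm => // y yC.
by apply: induced_circle => //; apply: h0.
Qed.

Lemma circle_perm_scale a b c : circle c ->
  circle_perm a b -> circle_perm (a / c ^+ 2) (b / c).
Proof.
move=> cC [h0 g_inj]; have c0 := circle_neq0 cC.
have hE y : quad (a / c ^+ 2) (b / c) y = quad a b (c * y) / c ^+ 2.
  by rewrite /quad; field.
have gE y : induced (a / c ^+ 2) (b / c) y =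
    induced a b (c * y) * (c^-1 * (c ^- 2) ^+ q.-1).
  rewrite /induced hE [in LHS]exprMn; move: (_ ^+ q.-1) (_ ^+ q.-1) => u v.
  by field.
split=> [y yC | x y xC yC].
  by rewrite hE mulf_neq0 ?invr_neq0 ?sqrf_eq0 ?h0 ?circleM.
rewrite !gE => /mulIf gxy; apply: (mulfI c0); apply: g_inj; try exact: circleM.
by apply: gxy; rewrite mulf_neq0 ?expf_neq0 ?invr_neq0 ?expf_neq0.
Qed.

Lemma circle_perm_scaleE a b c : circle c ->
  circle_perm a b <-> circle_perm (a / c ^+ 2) (b / c).
Proof.
move=> cC; have c0 := circle_neq0 cC; split; first exact: circle_perm_scale.
move=> /(circle_perm_scale (circleV cC)).
by rewrite exprVn !invrK !divfK // sqrf_eq0.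
Qed.

(** The induced map is y^-3, and 3 divides q + 1 exactly when n is odd. *)
Lemma circle_perm00 : circle_perm 0 0 <-> ~~ odd n.
Proof.
have quad00 y : quad 0 0 y = y ^+ 2 by rewrite /quad mul0r !add0r.
have inducedE00 y : circle y -> induced 0 0 y = y ^- 3.
  move=> yC; have y0 := circle_neq0 yC.
  rewrite inducedE // ?quad00 ?sqrf_eq0 // expr0n gtn_eqF ?(ltnW q_gt1) //.
  by rewrite /= !mul0r !add0r mul1r -exprS.
have q_mod3 : (q %% 3 = if odd n then 2 else 1)%N.
  rewrite q_def; elim: n => // m IHm; rewrite expnS -modnMmr IHm /=.
  by case: (odd m).
split=> [[_ g_inj] | n_even].
  apply/negP => n_odd; rewrite n_odd in q_mod3.
  have [z z_prim] := circle_generator.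
  have q3 : (q.+1 = q.+1 %/ 3 * 3)%N.
    by have := divn_eq q.+1 3; lia.
  pose w := z ^+ (q.+1 %/ 3).
  have w3 : w ^+ 3 = 1 by rewrite -exprM -q3 prim_expr_order.
  have w1 : w != 1.
    by rewrite -(prim_order_dvd z_prim) gtnNdvd //; have := q3; lia.
  have wC : circle w by apply: circleX; rewrite /circle /= prim_expr_order.
  case/eqP: w1; apply: g_inj; rewrite ?inducedE00 ?circle1 ?w3 ?expr1n //.
  exact: circle1.
rewrite (negbTE n_even) in q_mod3.
split=> [y yC | x y xC yC]; first by rewrite quad00 sqrf_eq0 circle_neq0.
rewrite !inducedE00 // => /invr_inj xy3.
have y0 := circle_neq0 yC; pose t := x / y.
have tC : circle t by apply: circleM => //; apply: circleV.
have t3 : t ^+ 3 = 1 by rewrite exprMn exprVn xy3 divff // expf_neq0.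
have t1 : t = 1.
  apply: circle_fixed => //; rewrite {1}(divn_eq q 3) q_mod3 exprD expr1.
  by rewrite mulnC exprM t3 expr1n mul1r.
by rewrite -(divfK y0 x) -/t t1 mul1r.
Qed.

(** * First power sum *)

Lemma circle_perm_b0 (a : F) : circle_perm a 0 -> a = 0.
Proof.
move=> perm_a; have := sum_induced 1 perm_a.
rewrite gtnNdvd ?ltnS ?(ltnW q_gt1) // => sum0.
(* (a + y^2)^(q-1) is (a^q + y^(2q)) / (a + y^2), a geometric sum. *)
have gE y : circle y -> induced a 0 y ^+ 1 =
    \sum_(i < q) a ^+ (q.-1 - i) * y ^+ (2 * i).+1.
  move=> yC; have hy0 := perm_a.1 y yC.
  have := subrXX a (y ^+ 2) q.
  rewrite !(GRing.subr_pchar2 pchar2_F) -frobD.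
  have -> : a + y ^+ 2 = quad a 0 y by rewrite /quad mul0r addr0.
  rewrite expr1 /induced frob_pred // => ->.
  rewrite [_ * _ / _]mulrAC divff // mul1r mulr_sumr; apply: eq_bigr => i _.
  by rewrite [y ^+ (2 * i).+1]exprS exprM mulrCA.
move: sum0; rewrite (eq_bigr _ gE) exchange_big /=.
(* 2 i + 1 = q + 1 is the only multiple of q + 1 among the exponents. *)
have q2_lt : (q./2 < q)%N by have := q_even; have := q_gt1; lia.
rewrite (bigD1 (Ordinal q2_lt)) //= -mulr_sumr sum_circle_exp.
rewrite mul2n q_even dvdnn.
rewrite big1 => [|i i_neq]; last first.
  rewrite -mulr_sumr sum_circle_exp.
  case: dvdnP => [[k kE]|_]; rewrite ?mulr0 //.
  case/eqP: i_neq; apply: val_inj => /=.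
  have := ltn_ord i; case: k kE => [|[|k]] kE; [lia | lia |].
  by rewrite !mulSn in kE; lia.
rewrite addr0 mulr1 => /eqP; rewrite expf_eq0 => /andP[_ /eqP //].
Qed.

(** With z = y / b and u = z^2 + z + a / b^2, the quotient S of tr2 u by u
    satisfies u^(q-1) = 1 + S + S * tr2 u, where tr2 u = z^q + z + tr2 (a / b^2),
    and only the constant term of S survives the summation over the circle. *)
Lemma circle_perm_trace (a b : F) : b != 0 -> circle_perm a b ->
  a != 0 /\ tr2 n (a / b ^+ 2) = 0.
Proof.
move=> b0 perm_ab; have := sum_induced 1 perm_ab.
rewrite gtnNdvd ?ltnS ?(ltnW q_gt1) // => sum0.
set A := a / b ^+ 2; set T := tr2 n A.
pose v : {poly F} := Poly [:: A; b^-1; b ^- 2].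
pose S := \sum_(i < n) v ^+ (2 ^ i).-1.
have vE y : v.[y] = quad a b y / b ^+ 2.
  by rewrite horner_Poly /= /quad /A; field.
have v0 : v.[0] = A by rewrite horner_Poly /= !mulr0 add0r.
have SE y : S.[y] * v.[y] = tr2 n v.[y].
  rewrite horner_sum mulr_suml; apply: eq_bigr => i _.
  by rewrite horner_exp -exprSr prednK ?expn_gt0.
have size_v : (size v <= 3)%N := size_Poly _.
have size_S : (size S <= q.-1)%N.
  rewrite (leq_trans (size_sum _ _ _)) //; apply/bigmax_leqP => i _.
  rewrite (leq_trans (size_poly_exp_leq _ _)) //.
  have : ((size v).-1 * (2 ^ i).-1 <= 2 * (2 ^ i).-1)%N.
    by rewrite leq_mul // -subn1 leq_subLR.
  have : (2 * 2 ^ i <= q)%N by rewrite q_def -expnS leq_exp2l.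
  have := expn_gt0 2 i; lia.
have S0 : \sum_(y | circle y) S.[y] = S.[0].
  by apply: sum_circle_horner; have := q_gt1; lia.
have XS_0 k : (0 < k <= 2)%N -> \sum_(y | circle y) y ^+ k * S.[y] = 0.
  move=> /andP[k_gt0 k_le2].
  have XkE y : y ^+ k * S.[y] = ('X^k * S).[y] by rewrite !hornerE.
  rewrite (eq_bigr _ (fun y _ => XkE y)) sum_circle_horner -?XkE.
    by rewrite expr0n gtn_eqF // mul0r.
  rewrite (leq_trans (size_polyMleq _ _)) // size_polyXn.
  by have := q_gt1; lia.
have gE y : circle y -> induced a b y ^+ 1 = b ^+ 2 ^+ q.-1 *
    (y ^+ 1 + y ^+ 1 * S.[y] * (1 + T) + y ^+ 2 * S.[y] / b + S.[y] / b ^+ q).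
  move=> yC; have hy0 := perm_ab.1 y yC; have y0 := circle_neq0 yC.
  have b20 : b ^+ 2 != 0 by rewrite sqrf_eq0.
  have u0 : v.[y] != 0 by rewrite vE mulf_neq0 ?invr_neq0.
  have uE : v.[y] = (y / b) ^+ 2 + y / b + A.
    by rewrite vE /quad /A; field.
  have trE : tr2 n v.[y] = (y / b) ^+ q + y / b + T.
    by rewrite uE tr2D ?tr2_artin_schreier -?q_def //; exact: pchar2_F.
  have u_frob : v.[y] ^+ q = tr2 n v.[y] ^+ 2 + tr2 n v.[y] + v.[y].
    rewrite (tr2_sqr _ pchar2_F) -tr2D; last exact: pchar2_F.
    rewrite tr2_artin_schreier -?q_def; last exact: pchar2_F.
    by rewrite -addrA addxx addr0.
  have -> : induced a b y ^+ 1 = b ^+ 2 ^+ q.-1 * (y * v.[y] ^+ q.-1).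
    by rewrite vE expr1 /induced mulrCA -exprMn [b ^+ 2 * _]mulrC divfK.
  congr (_ * _); rewrite frob_pred // u_frob -SE.
  have -> : ((S.[y] * v.[y]) ^+ 2 + S.[y] * v.[y] + v.[y]) / v.[y] =
      S.[y] * (S.[y] * v.[y]) + S.[y] + 1 by field.
  rewrite SE trE exprMn (circle_frob yC) exprVn; have := expf_neq0 q b0.
  move: S.[y] (b ^+ q) => s bq bq0; field2 two0F.
  by rewrite b0 bq0 y0.
move: sum0; rewrite (eq_bigr _ gE) -mulr_sumr !big_split /=.
rewrite -!mulr_suml sum_circle_exp gtnNdvd ?ltnS ?(ltnW q_gt1) //.
rewrite S0 !XS_0 // !mul0r !add0r => /eqP.
rewrite !mulf_eq0 !expf_eq0 invr_eq0 !expf_eq0 (negbTE b0) !andbF orbF /=.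
move=> /eqP S00.
have trA : T = 0 by rewrite /T -v0 -SE S00 mul0r.
split=> //; apply: contra_eq_neq S00 => a0.
rewrite horner_sum (bigD1 (Ordinal n_gt0)) //= hornerC.
rewrite big1 ?addr0 ?oner_eq0 // => i i_neq0.
rewrite horner_exp v0 /A a0 mul0r expr0n; case: eqP => // i0.
case/eqP: i_neq0; apply: val_inj => /=; move: i0.
case: (val i) => // m; rewrite expnS; have := expn_gt0 2 m; lia.
Qed.

(** * The degenerate case *)

(** For a = b^(1-q) the induced map is b^(q-1) / y. *)
Lemma circle_perm_degenerate (b : F) : b != 0 ->
  tr2 n ((b * b ^+ q)^-1) = 0 -> circle_perm (b / b ^+ q) b.
Proof.
move=> b0 tr0; set a := b / b ^+ q.
have bq0 : b ^+ q != 0 by rewrite expf_neq0.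
have h0 y : circle y -> quad a b y != 0.
  move=> yC; apply/eqP => hy; have y0 := circle_neq0 yC.
  have : tr2 n ((y / b) ^+ 2 + y / b) = 0.
    rewrite -tr0; congr tr2; apply/subr0_eq.
    transitivity (quad a b y / b ^+ 2); last by rewrite hy mul0r.
    rewrite (GRing.subr_pchar2 pchar2_F) /quad /a; field.
    by rewrite b0 bq0.
  rewrite (tr2_artin_schreier _ pchar2_F) -q_def => /eqP.
  rewrite addr_eq0F exprMn exprVn circle_frob // => /eqP yb.
  have y2 : y ^+ 2 = a.
    have : y / b * (y * b) = y^-1 / b ^+ q * (y * b) by rewrite yb.
    have -> : y / b * (y * b) = y ^+ 2 by field.
    by move=> ->; rewrite /a; field; rewrite y0 bq0.
  move: hy; rewrite /quad y2 addrC addrA addxx add0r => /eqP.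
  by rewrite mulf_eq0 (negbTE b0) (negbTE y0).
split=> // x y xC yC.
have gE z : circle z -> induced a b z = b ^+ q / b / z.
  move=> zC; have hz := h0 z zC; have z0 := circle_neq0 zC.
  have aq : a ^+ q = b ^+ q / b by rewrite /a exprMn exprVn frobK.
  rewrite inducedE // aq; move: hz; rewrite /quad /a => hz; field.
  have -> : b + b * z * b ^+ q + z ^+ 2 * b ^+ q =
      b ^+ q * (b / b ^+ q + b * z + z ^+ 2) by field.
  by rewrite z0 b0 bq0 mulf_neq0.
rewrite !gE // => /(mulfI _)/invr_inj; apply.
by rewrite mulf_neq0 ?invr_neq0.
Qed.

(** * The generic case over the subfield *)

(** If x != y have the same image, w = x / (x + y) satisfies w^q = w + 1, so
    w^2 + w has trace one. It also equals A + A / t + (A / t)^2, where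
    A = a / b^2 has trace zero and t is in the subfield, or just A when x y = 1. *)
Lemma circle_perm_sufficient (a b : F) : a ^+ q = a -> b ^+ q = b -> b != 0 ->
  tr2 n (a / b ^+ 2) = 0 -> b ^+ 2 + a ^+ 2 + a = 0 -> circle_perm a b.
Proof.
move=> aq bq b0 trA abE.
have b2E : b ^+ 2 = a ^+ 2 + a.
  by apply: subr0_eq; rewrite (GRing.subr_pchar2 pchar2_F) addrA.
have a0 : a != 0.
  by apply: contraNneq b0 => a0; rewrite -sqrf_eq0 b2E a0 expr0n addr0.
have a1 : a != 1.
  by apply: contraNneq b0 => a1; rewrite -sqrf_eq0 b2E a1 expr1n addxx.
have h0 y : circle y -> quad a b y != 0.
  move=> yC; apply/eqP => hy.
  have uE : (y / b) ^+ 2 + y / b = a / b ^+ 2.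
    apply/subr0_eq.
    transitivity (quad a b y / b ^+ 2); last by rewrite hy mul0r.
    by rewrite (GRing.subr_pchar2 pchar2_F) /quad; field.
  have := trA; rewrite -uE (tr2_artin_schreier _ pchar2_F) -q_def => /eqP.
  rewrite addr_eq0F exprMn exprVn bq => /eqP/(mulIf _) yq.
  have y1 : y = 1 by apply: circle_fixed; rewrite ?yq ?invr_eq0.
  move: hy; rewrite /quad y1 mulr1 expr1n => ab1.
  case/eqP: a1; apply/eqP; rewrite -addr_eq0F.
  apply/eqP; transitivity ((a + b + 1) ^+ 2 + (b ^+ 2 + a ^+ 2 + a)).
    by ring2 two0F.
  by rewrite ab1 abE expr0n addr0.
split=> // x y xC yC gxy; apply/eqP; apply/negPn/negP => xy.
have x0 := circle_neq0 xC; have y0 := circle_neq0 yC.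
pose e := x + y; pose p := x * y.
have e0 : e != 0 by rewrite addr_eq0F.
(* The numerator of g(x) - g(y), divided by x + y. *)
have rel : a * p ^+ 2 + (1 + a) * p + a + b * e * (p + 1) + e ^+ 2 = 0.
  have hx := h0 x xC; have hy := h0 y yC.
  have : (a * x ^+ 2 + b * x + 1) * (y * quad a b y) =
         (a * y ^+ 2 + b * y + 1) * (x * quad a b x).
    apply/eqP; rewrite -eqr_div ?mulf_neq0 //; apply/eqP.
    by move: gxy; rewrite !inducedE // aq bq.
  move=> cross; apply: (mulfI e0); rewrite mulr0.
  move/eqP: cross; rewrite -addr_eq0F => /eqP cross.
  rewrite -[RHS]cross /quad /e /p; apply/subr0_eq.
  transitivity (e * (b ^+ 2 + a ^+ 2 + a) * p); last by rewrite abE mulr0 mul0r.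
  by rewrite /e /p; ring2 two0F.
have eq : e ^+ q = e / p.
  by rewrite /e /p frobD !circle_frob //; field; rewrite x0 y0.
have p0 : p != 0 by rewrite mulf_neq0.
pose w := x / e.
have wE : w ^+ 2 + w = p / e ^+ 2.
  by have := e0; rewrite /w /p /e => xy0; field2 two0F.
have trw : tr2 n (p / e ^+ 2) = 1.
  rewrite -wE (tr2_artin_schreier _ pchar2_F) -q_def /w exprMn exprVn eq.
  rewrite circle_frob // /p; have := e0; rewrite /e => xy0; field2 two0F.
  by rewrite xy0 x0 y0.
suff trw0 : tr2 n (p / e ^+ 2) = 0.
  by move/eqP: trw; rewrite trw0 eq_sym oner_eq0.
have [p1 | p1] := eqVneq p 1.
  have e2 : e ^+ 2 = 1 + a.
    by rewrite -[RHS]addr0 -rel p1; ring2 two0F.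
  have a10 : 1 + a != 0 by rewrite addr_eq0F eq_sym.
  suff -> : p / e ^+ 2 = a / b ^+ 2 by [].
  rewrite p1 b2E e2; have -> : a ^+ 2 + a = a * (1 + a) by ring.
  by field; rewrite a10 a0.
have p10 : p + 1 != 0 by rewrite addr_eq0F.
pose t := e / (b * (p + 1)).
have tq : t ^+ q = t.
  rewrite /t !exprMn exprVn exprMn bq eq frobD expr1n.
  have -> : p ^+ q = p^-1 by rewrite circle_frob // circleM.
  by field; rewrite b0 p0 p10.
suff -> : p / e ^+ 2 = a / b ^+ 2 + ((a / b ^+ 2 / t) ^+ 2 + a / b ^+ 2 / t).
  rewrite tr2D ?trA ?tr2_artin_schreier; try exact: pchar2_F.
  rewrite -q_def add0r exprMn exprVn tq.
  have -> : (a / b ^+ 2) ^+ q = a / b ^+ 2.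
    by rewrite q_def tr2_eq0_frob //; exact: pchar2_F.
  exact: addxx.
apply: subr0_eq.
transitivity ((p * (b ^+ 2 + a ^+ 2 + a) + a *
    (a * p ^+ 2 + (1 + a) * p + a + b * e * (p + 1) + e ^+ 2)) /
    (b ^+ 2 * e ^+ 2)); last by rewrite abE rel !mulr0 addr0 mul0r.
by rewrite /t; field2 two0F; rewrite e0 b0 p10.
Qed.

(** For r != 1 in the subfield, an involution of the circle. *)
Definition mobius (r y : F) : F := (1 + r * y) / (y + r).

Lemma mobius_den_neq0 r y : r ^+ q = r -> r != 1 -> circle y -> y + r != 0.
Proof.
move=> rq r1 yC; rewrite addr_eq0F; apply: contra_neq r1 => yr.
by rewrite -yr; apply: circle_fixed; rewrite // yr.
Qed.

Lemma sum_mobius r m : r ^+ q = r -> r != 1 ->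
  \sum_(y | circle y) mobius r y ^+ m = (q.+1 %| m)%N%:R.
Proof.
move=> rq r1; have r0 y : circle y -> y + r != 0 by apply: mobius_den_neq0.
have nE y : circle y -> 1 + r * y = y * (y + r) ^+ q.
  move=> yC; rewrite frobD rq circle_frob // mulrDr divff ?circle_neq0 //.
  by rewrite [r * y]mulrC.
apply: sum_circle_perm => [y yC | x y xC yC].
  rewrite /mobius nE // -mulrA -frob_pred ?r0 //.
  by apply: circleM => //; apply: circle_frob_pred; apply: r0.
move/eqP; rewrite /mobius eqr_div ?r0 // -addr_eq0F => /eqP cross.
apply/eqP; rewrite -addr_eq0F.
have : (x + y) * (1 + r) ^+ 2 = 0.
  by rewrite -[RHS]cross; ring2 two0F.
move/eqP; rewrite mulf_eq0 => /orP[// | ].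
by rewrite sqrf_eq0 [1 + r == 0]addr_eq0F [1 == r]eq_sym (negbTE r1).
Qed.

(** Power sums of a linear combination of functions X, Y, Z that multiply in
    pairs by a rule X Y = k (X + Y) + 1. *)

Section CubicSum.

Variable C : pred F.
Hypothesis sum1 : \sum_(y | C y) 1 = 1 :> F.

Lemma sum_sqr_mul (X Y : F -> F) (k : F) :
  \sum_(y | C y) X y = 0 -> \sum_(y | C y) Y y = 0 ->
  (forall y, C y -> X y * Y y = k * (X y + Y y) + 1) ->
  \sum_(y | C y) X y ^+ 2 * Y y = k.
Proof.
move=> X0 Y0 XYE.
have sumX2 : \sum_(y | C y) X y ^+ 2 = 0.
  by rewrite (sum_sqr_pchar2 pchar2_F) X0 expr0n.
rewrite (eq_bigr (fun y =>
  k * X y ^+ 2 + (k ^+ 2 + 1) * X y + k ^+ 2 * Y y + k * 1)).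
  by rewrite !big_split /= -!mulr_sumr sumX2 X0 Y0 sum1 !mulr0 !add0r mulr1.
move=> y yC; transitivity (X y * (X y * Y y)); first by ring.
rewrite XYE //.
transitivity (k * X y ^+ 2 + k * (X y * Y y) + X y); first by ring.
by rewrite XYE //; ring.
Qed.

Lemma sum_cube (X Y Z : F -> F) (al be ga k l m : F) :
  [/\ \sum_(y | C y) X y = 0, \sum_(y | C y) Y y = 0
    & \sum_(y | C y) Z y = 0] ->
  [/\ \sum_(y | C y) X y ^+ 3 = 0, \sum_(y | C y) Y y ^+ 3 = 0
    & \sum_(y | C y) Z y ^+ 3 = 0] ->
  (forall y, C y -> X y * Y y = k * (X y + Y y) + 1) ->
  (forall y, C y -> X y * Z y = l * (X y + Z y) + 1) ->
  (forall y, C y -> Y y * Z y = m * (Y y + Z y) + 1) ->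
  \sum_(y | C y) (al * X y + be * Y y + ga * Z y) ^+ 3 =
    al * be * (al + be) * k + al * ga * (al + ga) * l + be * ga * (be + ga) * m.
Proof.
move=> [X0 Y0 Z0] [X3 Y3 Z3] XY XZ YZ.
have swap (V W : F -> F) (c : F) :
  (forall y, C y -> V y * W y = c * (V y + W y) + 1) ->
  forall y, C y -> W y * V y = c * (W y + V y) + 1.
  by move=> VW y yC; rewrite mulrC VW // [V y + _]addrC.
rewrite (eq_bigr (fun y => al ^+ 3 * X y ^+ 3 + be ^+ 3 * Y y ^+ 3 +
  ga ^+ 3 * Z y ^+ 3 + al ^+ 2 * be * (X y ^+ 2 * Y y) +
  al ^+ 2 * ga * (X y ^+ 2 * Z y) + be ^+ 2 * al * (Y y ^+ 2 * X y) +
  be ^+ 2 * ga * (Y y ^+ 2 * Z y) + ga ^+ 2 * al * (Z y ^+ 2 * X y) +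
  ga ^+ 2 * be * (Z y ^+ 2 * Y y))) => [|y _]; last first.
  by ring2 two0F.
rewrite !big_split /= -!mulr_sumr X3 Y3 Z3.
rewrite (sum_sqr_mul X0 Y0 XY) (sum_sqr_mul X0 Z0 XZ) (sum_sqr_mul Y0 Z0 YZ).
rewrite (sum_sqr_mul Y0 X0 (swap _ _ _ XY)) (sum_sqr_mul Z0 X0 (swap _ _ _ XZ)).
by rewrite (sum_sqr_mul Z0 Y0 (swap _ _ _ YZ)); ring.
Qed.

End CubicSum.

(** Necessity: r and s are the roots of X^2 + b X + a. The induced map is the
    product of 1 / y and two involutions, and its cube sums to zero. *)
Lemma circle_perm_necessary (r s : F) :
  let a := r * s in let b := r + s in
  r ^+ q = r -> s ^+ q = s -> r != 0 -> s != 0 -> b != 0 -> a != 1 ->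
  circle_perm a b -> b ^+ 2 + a ^+ 2 + a = 0.
Proof.
move=> a b rq sq r0 s0 b0 a1 perm_ab.
have aq : a ^+ q = a by rewrite exprMn rq sq.
have bq : b ^+ q = b by rewrite frobD rq sq.
have quadE y : quad a b y = (y + r) * (y + s) by rewrite /quad /a /b; ring.
have := perm_ab.1 1 circle1; rewrite quadE mulf_eq0 !addr_eq0F negb_or.
rewrite ![1 == _]eq_sym => /andP[r1 s1].
(* Cubes need the exponent 3 to be at most q, and r is neither 0 nor 1. *)
have q_gt2 : (2 < q)%N.
  rewrite ltn_neqAle q_gt1 andbT; apply: contraNneq r1 => q2.
  by apply/eqP/(mulfI r0); rewrite mulr1 -expr2 q2 rq.
have a10 : 1 + a != 0 by rewrite addr_eq0F eq_sym.
have div3 m : (0 < m <= 3)%N -> (q.+1 %| m)%N = false.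
  by move=> /andP[m_gt0 m_le3]; apply/negbTE/negP => /dvdn_leq; lia.
have sum1 : \sum_(y | circle y) 1 = 1 :> F.
  by rewrite -[RHS](sum_circle_exp 0); apply: eq_bigr.
have sumV m : (0 < m <= 3)%N -> \sum_(y | circle y) y^-1 ^+ m = 0.
  move=> m_le3; rewrite sum_circle_perm ?div3 // => [y | x y _ _ /invr_inj //].
  exact: circleV.
have sumM t m : t ^+ q = t -> t != 1 -> (0 < m <= 3)%N ->
    \sum_(y | circle y) mobius t y ^+ m = 0.
  by move=> tq t1 m_le3; rewrite sum_mobius ?div3.
have VM t y : t ^+ q = t -> t != 0 -> t != 1 -> circle y ->
    y^-1 * mobius t y = t^-1 * (y^-1 + mobius t y) + 1.
  move=> tq t0 t1 yC; rewrite /mobius; field2 two0F.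
  by rewrite t0 (circle_neq0 yC) (mobius_den_neq0 tq t1 yC).
have MM y : circle y -> mobius r y * mobius s y =
    ((1 + a) / b) * (mobius r y + mobius s y) + 1.
  have b0' := b0; rewrite /b in b0' *.
  move=> yC; rewrite /mobius /a; field2 two0F.
  by rewrite b0' (mobius_den_neq0 rq r1 yC) (mobius_den_neq0 sq s1 yC).
have := sum_induced 3 perm_ab; rewrite div3 //.
(* The coefficients of the partial fraction decomposition of the induced map. *)
pose al := a^-1; pose be := (1 + a) / (r * b); pose ga := (1 + a) / (s * b).
rewrite (eq_bigr (fun y =>
  (al * y^-1 + be * mobius r y + ga * mobius s y) ^+ 3)) => [|y yC]; last first.
  congr (_ ^+ 3); rewrite inducedE ?perm_ab.1 // aq bq quadE.
  rewrite /al /be /ga /mobius /a /b; field2 two0F.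
  rewrite r0 s0 (circle_neq0 yC) (mobius_den_neq0 rq r1 yC).
  by rewrite (mobius_den_neq0 sq s1 yC) [r + s != 0]b0.
rewrite (@sum_cube _ sum1 _ _ _ _ _ _ r^-1 s^-1 ((1 + a) / b)) //; first last.
- by move=> y yC; apply: VM.
- by move=> y yC; apply: VM.
- by split; [apply: sumV | apply: sumM | apply: sumM].
- by split; [apply: (sumV 1) | apply: (sumM _ 1) | apply: (sumM _ 1)].
set L := (X in X = 0 -> _) => L0.
have inv2 : r ^- 2 + s ^- 2 = b ^+ 2 / a ^+ 2.
  by rewrite /a /b; field2 two0F; rewrite r0 s0.
have inv3 : r ^- 3 + s ^- 3 = b * (b ^+ 2 + a) / a ^+ 3.
  by rewrite /a /b; field2 two0F; rewrite r0 s0.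
have inv1 : r^-1 + s^-1 = b / a by rewrite /a /b; field; rewrite r0 s0.
have a0 : a != 0 by rewrite mulf_neq0.
have LE : L = al ^+ 2 * ((1 + a) / b) * (r ^- 2 + s ^- 2) +
    al * ((1 + a) / b) ^+ 2 * (r ^- 3 + s ^- 3) +
    ((1 + a) / b) ^+ 4 * (r * s)^-1 * (r^-1 + s^-1).
  rewrite /L /be /ga; move: (1 + a) (al) (b) b0 => c al' b' b'0.
  by field; rewrite r0 s0 b'0.
have : (b ^+ 2 + a ^+ 2 + a) * (b + (1 + a)) ^+ 2 = 0.
  transitivity (L * (b ^+ 3 * a ^+ 3 / (1 + a))); last by rewrite L0 mul0r.
  rewrite LE inv1 inv2 inv3 -/a /al.
  move: (a) (b) a0 b0 a10 => a' b' a'0 b'0 a'10.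
  by field2 two0F; rewrite a'0 b'0 a'10.
move/eqP; rewrite mulf_eq0 sqrf_eq0 => /orP[/eqP // | /eqP ab1].
have := perm_ab.1 1 circle1; rewrite /quad mulr1 expr1n.
have -> : a + b + 1 = b + (1 + a) by ring.
by rewrite ab1 eqxx.
Qed.

(** Rescaling by an element of the circle moves b, and with it a, into the
    subfield. The existence of z splits the quadratic over the subfield. *)
Lemma circle_perm_generic (a b : F) : a != 0 -> b != 0 -> a != b / b ^+ q ->
  tr2 n (a / b ^+ 2) = 0 -> (exists2 z, z ^+ q = z & z ^+ 2 + z = a / b ^+ 2) ->
  circle_perm a b <-> b ^+ 2 + a ^+ 2 * b ^+ (q - 1) + a = 0.
Proof.
move=> a0 b0 ab trA [z zq zE].
have bq0 : b ^+ q != 0 by rewrite expf_neq0.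
(* c^2 = b^(1-q) gives c^(q-1) = c^-2 = b^(q-1), so b / c is fixed. *)
have := circleV (circle_frob_pred b0); rewrite frob_pred // invf_div.
move=> /circle_sqrt[c cC c2]; have c0 := circle_neq0 cC.
have Aq : (a / b ^+ 2) ^+ q = a / b ^+ 2.
  by rewrite q_def tr2_eq0_frob //; exact: pchar2_F.
rewrite (circle_perm_scaleE a b cC).
set a' := a / c ^+ 2; set b' := b / c.
have a'E : a' = a / b ^+ 2 * b' ^+ 2 by rewrite /a' /b'; field; rewrite b0 c0.
have b'q : b' ^+ q = b'.
  rewrite /b' exprMn exprVn (circle_frob cC) invrK; apply: (mulIf c0).
  by rewrite divfK // -mulrA -expr2 c2 mulrC divfK.
have a'q : a' ^+ q = a' by rewrite a'E exprMn Aq exprAC b'q.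
have b'0 : b' != 0 by rewrite mulf_neq0 ?invr_neq0.
have trA' : tr2 n (a' / b' ^+ 2) = 0 by rewrite a'E mulfK ?sqrf_eq0.
have a'1 : a' != 1.
  apply: contraNneq ab => a'1; rewrite -c2.
  by rewrite -[a](divfK (x := c ^+ 2)) ?sqrf_eq0 // -/a' a'1 mul1r.
have <- : b' ^+ 2 + a' ^+ 2 + a' = 0 <-> b ^+ 2 + a ^+ 2 * b ^+ (q - 1) + a = 0.
  have -> : b' ^+ 2 + a' ^+ 2 + a' =
      (b ^+ 2 + a ^+ 2 * b ^+ (q - 1) + a) / c ^+ 2.
    rewrite subn1 frob_pred // /b' /a' !expr_div_n c2.
    move: (b ^+ q) bq0 => bq bq0.
    by field; rewrite b0 bq0.
  split=> [/eqP | ->]; last by rewrite mul0r.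
  by rewrite mulf_eq0 invr_eq0 sqrf_eq0 (negbTE c0) orbF => /eqP.
split; last by move=> abE; apply: circle_perm_sufficient.
pose r := b' * z; pose s := b' * (z + 1).
have rs_b : r + s = b' by rewrite /r /s; ring2 two0F.
have rs_a : r * s = a'.
  by rewrite a'E -zE /r /s; ring.
have a'0 : a' != 0 by rewrite mulf_neq0 ?invr_neq0 ?sqrf_eq0.
have : r * s != 0 by rewrite rs_a.
rewrite mulf_eq0 negb_or => /andP[r0 s0].
rewrite -rs_b -rs_a in b'0 a'1 *; apply: circle_perm_necessary => //.
  by rewrite /r exprMn zq b'q.
by rewrite /s exprMn frobD zq expr1n b'q.
Qed.

End Circle.

(** * Descent to the subfield *)

Lemma frob_fixed_image (K L : finFieldType) (iota : {rmorphism K -> L})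
    (x : L) :
  x ^+ #|K| = x -> exists c, iota c = x.
Proof.
move=> xq; have := congr1 (map_poly iota) (finField_genPoly K).
rewrite rmorphB /= map_polyXn map_polyX rmorph_prod.
move=> /(congr1 (horner^~ x)) /=.
rewrite !hornerE xq subrr horner_prod => /esym/eqP/prodf_eq0[c _].
by rewrite /= map_polyXsubC !hornerE subr_eq0 => /eqP xc; exists c.
Qed.

Lemma abs_trace2E (K : finFieldType) (n : nat) (c : K) :
  #|K| = (2 ^ n)%N -> abs_trace2 c = tr2 n c.
Proof. by move=> cardK; rewrite /abs_trace2 cardK pfactorK. Qed.

Lemma trace_image (K L : finFieldType) (iota : {rmorphism K -> L}) (n : nat)
    (x : L) : 2%N \in [pchar L] -> #|K| = (2 ^ n)%N ->
  (exists2 c, iota c = x & abs_trace2 c = 0) <-> tr2 n x = 0.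
Proof.
move=> L2 cardK; split=> [[c <-]|trx].
  by rewrite (abs_trace2E c cardK) -tr2_rmorph => ->; rewrite rmorph0.
have := tr2_eq0_frob L2 trx; rewrite -cardK.
move=> /frob_fixed_image-/(_ iota)[c cx].
exists c => //; rewrite (abs_trace2E c cardK); apply: (fmorph_inj iota).
by rewrite tr2_rmorph cx trx rmorph0.
Qed.

Theorem theoremB (q n : nat) (n_gt0 : (0 < n)%N) (q_def : q = (2 ^ n)%N)
    (Fq Fq2 : finFieldType) (iota : {rmorphism Fq -> Fq2})
    (card_Fq : #|Fq| = q) (card_Fq2 : #|Fq2| = (q ^ 2)%N)
    (a b : Fq2) :
  perm_poly (a *: 'X + b *: 'X^q + 'X^(2 * q - 1)) <->
  [\/ [/\ a = 0, b = 0 & exists2 k : nat, (0 < k)%N & q = (2 ^ (2 * k))%N],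
      [/\ a * b != 0,
          a = b ^ (1 - q%:Z)
        & exists2 c : Fq, iota c = b ^ (- 1 - q%:Z) & abs_trace2 c = 0]
    | [/\ a * b * (a - b ^ (1 - q%:Z)) != 0,
          (exists2 c : Fq, iota c = a / b ^+ 2 & abs_trace2 c = 0)
        & b ^+ 2 + a ^+ 2 * b ^+ (q - 1) + a = 0]].
Proof.
rewrite (perm_polyP n_gt0 q_def card_Fq2).
have F2 := pchar2_F q_def card_Fq2.
have cardK : #|Fq| = (2 ^ n)%N by rewrite card_Fq.
have trE x := trace_image iota x F2 cardK.
have [b0 | b0] := eqVneq b 0.
  subst b; split=> [perm_a | ].
    have a0 := circle_perm_b0 n_gt0 q_def card_Fq2 perm_a; subst a.
    have /(circle_perm00 n_gt0 q_def card_Fq2) n_even := perm_a.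
    apply: Or31; split=> //; exists n./2.
      by case: (n) n_gt0 n_even => [|[|m]].
    by rewrite mul2n even_halfK.
  case=> [[-> _ [k _ qk]] | [] | []]; rewrite ?mulr0 ?mul0r ?eqxx //.
  have /eqP : (2 ^ n = 2 ^ (2 * k))%N by rewrite -q_def.
  rewrite eqn_exp2l // => /eqP nE.
  by apply/(circle_perm00 n_gt0 q_def card_Fq2); rewrite nE oddM.
have bq0 : b ^+ q != 0 by rewrite expf_neq0.
have bE1 : b ^ (1 - q%:Z) = b / b ^+ q by rewrite expfzDr // expr1z -exprnN.
have bE2 : b ^ (- 1 - q%:Z) = (b * b ^+ q)^-1.
  by rewrite expfzDr // -exprnN invfM.
have cross : a = b / b ^+ q -> a / b ^+ 2 = (b * b ^+ q)^-1.
  by move=> ->; move: (b ^+ q) bq0 => bq bq0; field; rewrite b0 bq0.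
have roots : tr2 n (a / b ^+ 2) = 0 ->
    exists2 z, z ^+ q = z & z ^+ 2 + z = a / b ^+ 2.
  move=> /trE[c cE]; rewrite (abs_trace2E c cardK) => trc.
  have [z zE] := artin_schreier_root n_gt0 cardK trc.
  exists (iota z); first by rewrite -rmorphXn -card_Fq expf_card.
  by rewrite -cE -zE rmorphD rmorphXn.
have generic a0 ab tr0 :=
  circle_perm_generic n_gt0 q_def card_Fq2 a0 b0 ab tr0 (roots tr0).
rewrite bE1 bE2; split=> [perm_ab | ].
  have [a0 trA] := circle_perm_trace n_gt0 q_def card_Fq2 b0 perm_ab.
  have [ab | ab] := eqVneq a (b / b ^+ q).
    by apply: Or32; split; rewrite ?mulf_neq0 //; apply/trE; rewrite -cross.
  apply: Or33; split; rewrite ?mulf_neq0 ?subr_eq0 //; first exact/trE.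
  by case: (generic a0 ab trA) => + _; apply.
case=> [[_ b_eq0] | [_ -> /trE trb] | []].
- by rewrite b_eq0 eqxx in b0.
- exact: (circle_perm_degenerate n_gt0 q_def card_Fq2 b0 trb).
rewrite !mulf_eq0 subr_eq0 !negb_or => /andP[/andP[a0 _] ab] /trE trA abE.
by case: (generic a0 ab trA) => _; apply.
Qed.
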